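(* Let $(G_n)_{n\ge 2}$ be a sequence of random graphs following the linear de-preferential attachment model with $m=1$, and let $i\ge 1$ be fixed. Then, as $n\to\infty$, $$\frac{d_i(n)}{\log n}\longrightarrow 1\quad\text{in probability.}$$
   Context: Linear de-preferential attachment model with $m=1$: the graph $G_n$ has vertices $v_1,\dots,v_n$, and $d_i(n)$ denotes the degree of $v_i$ in $G_n$ (all incident edges and half-edges counted). The process starts from $G_2$, consisting of two vertices $v_1,v_2$ joined by an edge together with one extra ''free'' edge (half-edge) attached to one of the two vertices, which counts toward that vertex's degree; thus the degrees in $G_2$ are $1$ and $2$, and the degrees in $G_n$ sum to $2n-1$. Given $G_n$, a new vertex $v_{n+1}$ is added with a single edge $e_{n+1}$ joining it to one of $v_1,\dots,v_n$. With $\mathscr{F}_n$ the natural filtration of the process, $$P(e_{n+1}=\{v_{n+1},v_i\}\mid \mathscr{F}_n)=\frac{1}{n-1}\left(1-\frac{d_i(n)}{2n-1}\right),\qquad i=1,\dots,n.$$ Thus the chosen vertex's degree increases by one and $d_{n+1}(n+1)=1$. *)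

(* Defs.v *)
From HB Require Import structures.
From mathcomp Require Import all_boot all_order all_algebra.
From mathcomp Require Import finmap.
From mathcomp Require Import all_classical all_reals all_analysis.

Set Implicit Arguments.
Unset Strict Implicit.
Unset Printing Implicit Defensive.

Import Order.TTheory GRing.Theory Num.Theory.
Import numFieldNormedType.Exports.

Local Open Scope classical_set_scope.
Local Open Scope ring_scope.

(* Graphs with one half-edge. The vertex v_i is the natural number i (labels
   start at 1), an ordinary edge is the set of its two endpoints, and the
   half-edge is given by the vertex it is attached to. *)
Record hgraph := HGraph {
  vertices : {fset nat};
  edges : {fset {fset nat}};
  half_edge : nat }.

Definition degree (g : hgraph) (i : nat) : nat :=
  (#|` [fset e in edges g | i \in e]%fset| + (half_edge g == i))%N.

Definition initial_graph (h : nat) : hgraph :=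
  HGraph [fset 1%N; 2%N]%fset [fset [fset 1%N; 2%N]]%fset h.

Definition add_vertex (g : hgraph) (v i : nat) : hgraph :=
  HGraph (v |` vertices g)%fset ([fset v; i] |` edges g)%fset (half_edge g).

(* The sigma-algebra generated by G_2, ..., G_n; the graphs take countably many
   values, so the events {G_k = g} generate it. *)
Definition natural_filtration (T : Type) (G : nat -> T -> hgraph) (n : nat) :
    set (set T) :=
  <<s [set A | exists k g, (2 <= k <= n)%N /\ A = [set w | G k w = g]] >>.

(* X is a version of the conditional probability P(A | F). *)
Definition is_cond_prob (d : measure_display) (T : measurableType d)
    (R : realType) (P : probability T R) (F : set (set T)) (A : set T)
    (X : T -> R) : Prop :=
  [/\ forall Y : set R, measurable Y -> F (X @^-1` Y),
      P.-integrable setT (EFin \o X) &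
      forall B, F B -> P (A `&` B) = (\int[P]_(w in B) (X w)%:E)%E].

(* The values G 0 and G 1 are unconstrained. *)
Record linear_depreferential_attachment (d : measure_display)
    (T : measurableType d) (R : realType) (P : probability T R)
    (G : nat -> T -> hgraph) : Prop := {
  lda_measurable : forall n g, (2 <= n)%N -> measurable [set w | G n w = g];
  lda_initial : forall w,
    G 2%N w = initial_graph 1 \/ G 2%N w = initial_graph 2;
  lda_step : forall n w, (2 <= n)%N ->
    exists2 i, (1 <= i <= n)%N & G n.+1 w = add_vertex (G n w) n.+1 i;
  lda_transition : forall n i, (2 <= n)%N -> (1 <= i <= n)%N ->
    is_cond_prob P (natural_filtration G n)
      [set w | G n.+1 w = add_vertex (G n w) n.+1 i]
      (fun w => 1 / (n%:R - 1) *
                (1 - (degree (G n w) i)%:R / (2 * n%:R - 1))) }.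

Definition cvg_in_probability (d : measure_display) (T : measurableType d)
    (R : realType) (P : probability T R) (X : nat -> T -> R) (c : R) : Prop :=
  forall eps : R, 0 < eps ->
    P [set w | eps < `|X n w - c|] @[n --> \oo] --> 0%E.

(* Main.v *)
(* Second moment method. Let D_n be the degree of v_i in G_n and let h_n be the
   harmonic number H_(n-2), so that h_(n+1) = h_n + 1/(n-1). Given F_n, D_n
   grows by one with probability (1 - D_n/(2n-1))/(n-1). The correction
   D_n/(2n-1) contributes -2 (D_n - h_n) D_n / ((n-1)(2n-1)) to the increment of
   E(D_n - h_n)^2, which is at most h_n^2 / (2(n-1)(2n-1)) by completing the
   square, hence at most 1/(n-1) because h_n^2 <= 4(n-2). So each step adds at
   most 3/(n-1), E(D_n - h_n)^2 = O(h_n) = O(log n), and Chebyshev's inequality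
   concludes since |h_n - log n| <= 1. *)
Require Import Defs.
From mathcomp Require Import all_boot all_order all_algebra finmap ring lra zify.
From mathcomp Require Import all_classical all_reals all_analysis.
Import Order.TTheory GRing.Theory Num.Theory.
Import numFieldNormedType.Exports.
Local Open Scope ring_scope.

Set Implicit Arguments.
Unset Strict Implicit.
Unset Printing Implicit Defensive.

(** * Events determined by a graph, and degrees under attachment *)

Lemma sigma_algebra_countable_preimage (T X : Type) (C : countType)
    (code : X -> C) (S : set (set T)) (f : T -> X) (Q : X -> Prop) :
  injective code -> sigma_algebra setT S ->
  (forall x, S [set w | f w = x]%classic) -> S [set w | Q (f w)]%classic.
Proof.
move=> code_inj [S0 _ SU] Sf.
(* Cutting the event along the countably many codes leaves pieces that are empty or a single fibre
   of [f]. *)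
rewrite [X in S X](_ : _ = (\bigcup_n
    [set w | Q (f w) /\ choice.pickle (code (f w)) = n])%classic); last first.
  apply/seteqP; split=> [w Qw|w [n _ []]] //=.
  by exists (choice.pickle (code (f w))).
apply: SU => n.
have [[w [Qw nw]]|noQ] :=
  pselect (exists w, Q (f w) /\ choice.pickle (code (f w)) = n).
  rewrite [X in S X](_ : _ = [set v | f v = f w]%classic); first exact: Sf.
  apply/seteqP; split=> [v [_ nv]|v /= ->] //=.
  by apply: code_inj; apply: (pcan_inj choice.pickleK); rewrite nv nw.
rewrite [X in S X](_ : _ = set0) //.
by apply/seteqP; split=> // v Qv; apply: noQ; exists v.
Qed.

Definition hgraph_code (g : hgraph) : {fset nat} * {fset {fset nat}} * nat :=
  (vertices g, edges g, half_edge g).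

Lemma hgraph_code_inj : injective hgraph_code.
Proof. by move=> [V E h] [V' E' h'] [-> -> ->]. Qed.

Lemma fset_filterU1 (K : choiceType) (x : K) (E : {fset K}) (p : pred K) :
  [fset e in (x |` E)%fset | p e]%fset =
  (if p x then x |` [fset e in E | p e] else [fset e in E | p e])%fset.
Proof.
apply/fsetP => e; case: ifPn => px; rewrite !inE /=; case: eqVneq => [->|] //=.
by rewrite (negbTE px) !andbF.
Qed.

(** Edges form a set, so the degree grows only if the new edge is fresh: it contains [v], while all
    old endpoints lie below [v]. *)
Lemma degree_add_vertex (g : hgraph) (v i j : nat) :
  (forall e, e \in edges g -> forall x, x \in e -> (x < v)%N) -> (i < v)%N ->
  degree (add_vertex g v j) i = (degree g i + (j == i))%N.
Proof.
move=> gv iv; rewrite /degree /= fset_filterU1 !inE (ltn_eqF iv) /= eq_sym.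
case: eqVneq => [->|_]; last by rewrite addn0.
rewrite cardfsU1 (_ : _ \notin _); first by rewrite -addnA addnC.
apply/negP; rewrite !inE => /andP[/gv/(_ v)].
by rewrite !inE eqxx ltnn => /(_ isT).
Qed.

(** Inserting an edge raises a cardinality by at most one, fresh or not; this also covers [i = v],
    as [degree_le_size] requires. *)
Lemma degree_add_vertex_le (g : hgraph) (v i j : nat) :
  (degree (add_vertex g v j) i <= (degree g i).+1)%N.
Proof.
rewrite /degree /= fset_filterU1; case: ifP => _; last exact: leqnSn.
by rewrite cardfsU1 -addnA -add1n leq_add2r leq_b1.
Qed.

Lemma degree_initial_graph_le (h i : nat) : (degree (initial_graph h) i <= 2)%N.
Proof.
rewrite /degree -(addn1 1) leq_add ?leq_b1 //=.
apply: (@leq_trans #|` [fset [fset 1%N; 2%N]]|%fset); last by rewrite cardfs1.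
by apply: fsubset_leq_card; apply/fsubsetP => e; rewrite !inE => /andP[].
Qed.

(** * Harmonic numbers and their distance to the logarithm *)

Lemma harmonic_series_ge0 (R : realType) (m : nat) : 0 <= (series harmonic m : R).
Proof. by rewrite /series /= sumr_ge0 // => k _; exact: harmonic_ge0. Qed.

Lemma harmonic_series_le (R : realType) (m : nat) :
  (series harmonic m : R) <= m%:R.
Proof.
elim: m => [|m Hm]; first by rewrite /series /= big_geq.
rewrite seriesSr -natr1; apply: lerD => //.
by rewrite /= invf_le1 // ler1n.
Qed.

(** Induction with [h = 1/(m+1)] and [H <= m]: the increment [2hH + h^2] is at most
    [2hm + h^2 <= 3]. *)
Lemma harmonic_series_sqr_le (R : realType) (m : nat) :
  (series harmonic m : R) ^+ 2 <= 4 * m%:R.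
Proof.
elim: m => [|m IH]; first by rewrite /series /= big_geq // expr0n mulr0.
rewrite seriesSr -natr1 /=.
have Hm := harmonic_series_le R m; have m0 : 0 <= m%:R :> R by [].
set H : R := series _ m in IH Hm *.
have h0 := @harmonic_gt0 R m; rewrite /= in h0.
have : m.+1%:R^-1 * m.+1%:R = 1 :> R by rewrite mulVf.
rewrite -natr1 in h0 *; set h : R := (_ + 1)^-1 in h0 * => hm.
rewrite mulrDr mulr1 in hm.
have hm0 : 0 <= h * m%:R by apply: mulr_ge0 => //; exact: ltW.
have h1 : h <= 1 by lra.
have h2 : h ^+ 2 <= 1 by rewrite expr_le1 // ltW.
have hH : h * H <= h * m%:R by apply: ler_wpM2l => //; exact: ltW.
rewrite sqrrD; lra.
Qed.

Lemma ln_le_harmonic_series (R : realType) (m : nat) :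
  ln (m.+1%:R : R) <= series harmonic m.
Proof.
elim: m => [|m IH]; first by rewrite /series /= big_geq // ln1.
rewrite seriesSr (_ : m.+2%:R = m.+1%:R * (1 + m.+1%:R^-1)); last first.
  by rewrite mulrDr mulr1 divff // natr1.
have h0 := @harmonic_gt0 R m; rewrite /= in h0.
rewrite lnM ?posrE ?ltr0n ?addr_gt0 //.
by apply: lerD => //; apply: le_ln1Dx; rewrite (lt_trans _ h0) // oppr_lt0.
Qed.

Lemma harmonic_series_le_ln (R : realType) (m : nat) :
  series harmonic m.+1 <= 1 + ln (m.+1%:R : R).
Proof.
elim: m => [|m IH]; first by rewrite /series /= big_nat1 ln1 addr0 /= invr1.
rewrite -[m.+1%:R](_ : m.+2%:R * (1 - m.+2%:R^-1) = _) in IH; last first.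
  by rewrite mulrBr mulr1 divff // -(natr1 m.+1) addrK.
have h1 : m.+2%:R^-1 < 1 :> R by rewrite invf_lt1 // ltr1n.
rewrite lnM ?posrE ?ltr0n ?subr_gt0 // in IH.
rewrite seriesSr /=; set x : R := m.+2%:R^-1 in h1 IH *.
by have : ln (1 - x) <= - x; [apply: le_ln1Dx; lra | lra].
Qed.

Lemma harmonic_series_ln_dist (R : realType) (n : nat) : (2 < n)%N ->
  `|series harmonic n.-2 - ln (n%:R : R)| <= 1.
Proof.
case: n => [|[|[|m]]] // _; rewrite succnK /=.
(* Here [n = m+3], and the series stops at [m+1]. The upper bound loses only the monotonicity of
   [ln]; the lower one holds for [m+2] terms, and the extra term is at most 1. *)
have H1 := harmonic_series_le_ln R m; have H2 := ln_le_harmonic_series R m.+2.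
have L : ln (m.+1%:R : R) <= ln m.+3%:R by rewrite ler_ln ?posrE ?ltr0n // ler_nat; lia.
rewrite seriesSr in H2; have := @harmonic_ge0 R m.+1.
have : (harmonic m.+1 : R) <= 1 by rewrite /= invf_le1 // ler1n.
by rewrite ler_norml => h0 h1; lra.
Qed.

Lemma cvg_ln_nat (R : realType) : (ln (n%:R : R) @[n --> \oo] --> +oo)%classic.
Proof.
apply/cvgryPge => A; have := @cvgr_idn R => /cvgryPge /(_ (expR A)).
apply: filterS => n An; rewrite -(expRK A) ler_ln ?posrE ?expR_gt0 //.
exact: lt_le_trans (expR_gt0 A) An.
Qed.

(** * Second moment of the degree as a Markov chain on the naturals *)

Definition attach_prob (R : realType) (n k : nat) : R :=
  1 / (n%:R - 1) * (1 - k%:R / (2 * n%:R - 1)).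

Lemma second_moment_increment (R : realType) (m k : nat) (h p : R) :
  (k <= m.+2)%N -> h = series harmonic m -> p = attach_prob R m.+2 k ->
  p * (k.+1%:R - (h + harmonic m)) ^+ 2 + (1 - p) * (k%:R - (h + harmonic m)) ^+ 2 <=
  (k%:R - h) ^+ 2 + 3 * harmonic m.
Proof.
move=> km hE pE; have h2 := harmonic_series_sqr_le R m; rewrite -hE in h2.
have a0 := @harmonic_gt0 R m.
have a1 : (harmonic m : R) <= 1 by rewrite /= invf_le1 // ler1n.
have {}pE : p = harmonic m * (1 - k%:R / (2 * m.+2%:R - 1)).
  by rewrite pE /attach_prob /= div1r -(natr1 m.+1) addrK.
rewrite -(natr1 k) {}pE {p hE}; set a : R := harmonic m in a0 a1 *.
have k0 : 0 <= k%:R :> R by [].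
have m0 : 0 <= m%:R :> R by [].
have {}km : k%:R <= m%:R + 2 :> R by rewrite -natrD ler_nat addn2.
have -> : 2 * m.+2%:R - 1 = 2 * m%:R + 3 :> R by rewrite -addn2 natrD; ring.
set s : R := _ / _.
have s0 : 0 <= s by apply: divr_ge0; lra.
have s1 : s <= 1 by rewrite /s ler_pdivrMr; lra.
(* Completing the square: [k(k-h) >= -h^2/4 >= -m], which exceeds [-(2m+3)/2]. *)
have sk : - (1 / 2) <= s * (k%:R - h).
  rewrite /s mulrAC ler_pdivlMr; last by lra.
  have := sqr_ge0 (k%:R - h / 2); lra.
(* The budget [3a] pays one [a] each for the drift [-2as(k-h)], for [a^2] from the shifted centre,
   and for the jump probability [a(1-s)]; the slack is a sum of nonnegative terms. *)
have : (k%:R - h) ^+ 2 + 3 * a - (a * (1 - s) * (k%:R + 1 - (h + a)) ^+ 2 +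
  (1 - a * (1 - s)) * (k%:R - (h + a)) ^+ 2) =
  a * (1 + 2 * (s * (k%:R - h))) + a * (1 - a) + a * s + 2 * (a ^+ 2 * (1 - s)).
  by ring.
have : 0 <= a * (1 + 2 * (s * (k%:R - h))) by apply: mulr_ge0; lra.
have : 0 <= a * (1 - a) by apply: mulr_ge0; lra.
have : 0 <= a * s by apply: mulr_ge0; lra.
have : 0 <= a ^+ 2 * (1 - s) by apply: mulr_ge0; [exact: sqr_ge0|lra].
lra.
Qed.

Lemma cvg_inv_ln_nat (R : realType) (K : R) :
  ((K / ln (n%:R : R))%:E @[n --> \oo] --> 0%E)%classic.
Proof.
have /gtr0_cvgV0 [_ /(_ (@cvg_ln_nat R)) V0] :
  \forall n \near \oo%classic, 0 < ln (n%:R : R).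
  by have /cvgryPgt /(_ 0) := @cvg_ln_nat R.
have := cvgM (cvg_cst K) V0; rewrite mulr0 => KV0.
by apply: cvg_EFin; [exact: nearW|exact: KV0].
Qed.

(* [q n k] plays the role of [P (D_n = k)]; its total mass is not required to
   be 1, only conserved. *)
Definition attach_chain (R : realType) (n0 : nat) (q : nat -> nat -> R) : Prop :=
  forall n, (n0 <= n)%N ->
  [/\ forall k, 0 <= q n k, forall k, (n < k)%N -> q n k = 0,
      q n.+1 0%N = q n 0%N * (1 - attach_prob R n 0) &
      forall k, q n.+1 k.+1 =
        q n k * attach_prob R n k + q n k.+1 * (1 - attach_prob R n k.+1)].

Definition chain_mean (R : realType) (q : nat -> nat -> R) (n : nat) (f : nat -> R) : R :=
  \sum_(k < n.+1) q n k * f k.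

Lemma chain_mean_step (R : realType) (n0 : nat) (q : nat -> nat -> R) (n : nat)
    (f : nat -> R) : attach_chain n0 q -> (n0 <= n)%N ->
  chain_mean q n.+1 f = chain_mean q n (fun k =>
    attach_prob R n k * f k.+1 + (1 - attach_prob R n k) * f k).
Proof.
move=> chain_q /chain_q[_ qn q0 qS]; rewrite /chain_mean big_ord_recl /=.
under eq_bigr => k _ do rewrite /bump /= qS mulrDl.
rewrite big_split /= addrCA.
under [RHS]eq_bigr => k _ do rewrite mulrDr.
rewrite big_split /=; congr (_ + _).
  by apply: eq_bigr => k _; rewrite mulrA.
(* The staying terms: the value 0 is reached only by staying, and the extra index [n+1] carries no
   mass at time [n]. *)
transitivity (\sum_(k < n.+2) q n k * ((1 - attach_prob R n k) * f k)).
  rewrite [RHS]big_ord_recl /= q0 mulrA; congr (_ + _).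
  by apply: eq_bigr => k _; rewrite mulrA.
by rewrite big_ord_recr /= qn // mul0r addr0.
Qed.

Lemma chain_mean_ge0 (R : realType) (n0 : nat) (q : nat -> nat -> R) (n : nat)
    (f : nat -> R) : attach_chain n0 q -> (n0 <= n)%N -> (forall k, 0 <= f k) ->
  0 <= chain_mean q n f.
Proof.
move=> chain_q /chain_q[q0 _ _ _] f0.
by rewrite /chain_mean sumr_ge0 // => k _; rewrite mulr_ge0.
Qed.

(** Averaging [second_moment_increment] adds at most [3M/(n-1)] per step, [M] being the conserved
    mass, and these increments sum to a harmonic number. The law at time [n0] enters only through
    the constant. *)
Lemma chain_second_moment (R : realType) (n0 : nat) (q : nat -> nat -> R) :
  attach_chain n0 q -> (2 <= n0)%N ->
  exists2 C : R, 0 <= C & forall n, (n0 <= n)%N ->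
    chain_mean q n (fun k => (k%:R - series harmonic n.-2) ^+ 2) <=
    C * (1 + series harmonic n.-2).
Proof.
move=> chain_q n02.
pose W n := chain_mean q n (fun k => (k%:R - series harmonic n.-2) ^+ 2).
pose M := chain_mean q n0 (fun=> 1).
have M0 : 0 <= M by exact: (chain_mean_ge0 chain_q).
have W0 : 0 <= W n0 by apply: (chain_mean_ge0 chain_q) => // k; exact: sqr_ge0.
have mass n : (n0 <= n)%N -> chain_mean q n (fun=> 1) = M.
  elim: n => [|n IH]; first by rewrite leqn0 => /eqP <-.
  rewrite leq_eqVlt => /orP[/eqP<- //|]; rewrite ltnS => n0n.
  rewrite (chain_mean_step _ chain_q) // -IH //.
  by apply: eq_bigr => k _; rewrite !mulr1 addrC subrK mulr1.
exists (W n0 + 3 * M) => [|n n0n]; first by rewrite addr_ge0 // mulr_ge0.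
rewrite -/(W n).
apply: (@le_trans _ _ (W n0 + 3 * M * series harmonic n.-2)); last first.
  have H0 := harmonic_series_ge0 R n.-2.
  have : 0 <= W n0 * series harmonic n.-2 by exact: mulr_ge0.
  lra.
elim: n n0n => [|n IH]; first by lia.
rewrite leq_eqVlt => /orP[/eqP<-|].
  by rewrite lerDl !mulr_ge0 // harmonic_series_ge0.
rewrite ltnS => n0n; have [m nE] : exists m, n = m.+2 by exists n.-2; lia.
have Hn : series harmonic n.+1.-2 = series harmonic n.-2 + harmonic n.-2 :> R.
  by rewrite nE /= seriesSr.
have : W n.+1 <= W n + 3 * M * harmonic n.-2; last by rewrite Hn; have := IH n0n; lra.
rewrite /W (chain_mean_step _ chain_q) // Hn -(mass n n0n).
have [q0 _ _ _] := chain_q n n0n.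
rewrite /chain_mean mulr_sumr mulr_suml -big_split /=; apply: ler_sum => k _.
rewrite [leRHS](_ : _ =
    q n k * ((k%:R - series harmonic n.-2) ^+ 2 + 3 * n.-2.+1%:R^-1)); last by ring.
have n2 : n.-2.+2 = n by rewrite nE.
apply: ler_wpM2l => //; apply: second_moment_increment; rewrite ?n2 //.
by rewrite -ltnS.
Qed.

(** * The degree of a fixed vertex in the graph process follows the chain *)

Section DegreeChain.
Context (d : measure_display) (T : measurableType d) (R : realType).
Context (P : probability T R) (G : nat -> T -> hgraph).
Hypothesis HG : linear_depreferential_attachment P G.

Lemma edges_le_size (n : nat) (w : T) : (2 <= n)%N ->
  forall e, e \in edges (G n w) -> forall x, x \in e -> (x <= n)%N.
Proof.
elim: n => [//|n IH]; rewrite leq_eqVlt => /orP[/eqP<-|].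
  move=> e; case: (lda_initial HG w) => ->; rewrite /= inE => /eqP-> x;
  by rewrite !inE => /orP[]/eqP->.
rewrite ltnS => n2; have [j /andP[_ jn] ->] := lda_step HG w n2.
move=> e; rewrite /= !inE => /orP[/eqP-> x|en x /(IH n2 _ en)]; last exact: leqW.
by rewrite !inE => /orP[]/eqP-> //; exact: leqW.
Qed.

Lemma degree_le_size (n i : nat) (w : T) : (2 <= n)%N -> (degree (G n w) i <= n)%N.
Proof.
elim: n => [//|n IH]; rewrite leq_eqVlt => /orP[/eqP<-|].
  by case: (lda_initial HG w) => ->; exact: degree_initial_graph_le.
rewrite ltnS => n2; have [j _ ->] := lda_step HG w n2.
by apply: leq_trans (degree_add_vertex_le _ _ _ _) _; exact: IH.
Qed.

(** Identifies the event of [lda_transition], an equality of graphs, with a jump of the degree. *)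
Lemma degree_step (n i : nat) (w : T) : (2 <= n)%N -> (i <= n)%N ->
  G n.+1 w = add_vertex (G n w) n.+1 i /\ degree (G n.+1 w) i = (degree (G n w) i).+1 \/
  G n.+1 w <> add_vertex (G n w) n.+1 i /\ degree (G n.+1 w) i = degree (G n w) i.
Proof.
move=> n2 ni; have [j _ Gj] := lda_step HG w n2.
have Dj : degree (G n.+1 w) i = (degree (G n w) i + (j == i))%N.
  rewrite Gj degree_add_vertex // => e en x xe; rewrite ltnS.
  exact: edges_le_size en _ xe.
case: eqVneq Dj => [<-|ji] /=; rewrite ?addn1 ?addn0 => Dj; [by left|right; split=> //].
(* Attaching at some [j] other than [i] cannot give the same graph as attaching at [i]: the degree
   of [i] would both stay and grow. *)
move=> Gi; move: Dj; rewrite Gi degree_add_vertex ?eqxx //.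
  by move=> /eqP; rewrite -[X in _ == X]addn0 eqn_add2l.
by move=> e en x xe; rewrite ltnS; exact: edges_le_size en _ xe.
Qed.

Lemma natural_filtration_preimage (n k : nat) (Q : hgraph -> Prop) :
  (2 <= k <= n)%N -> natural_filtration G n [set w | Q (G k w)]%classic.
Proof.
move=> kn; apply: (sigma_algebra_countable_preimage (f := G k) Q hgraph_code_inj).
  exact: smallest_sigma_algebra.
by move=> g; apply: sub_sigma_algebra; exists k, g.
Qed.

Lemma measurable_preimage_graph (n : nat) (Q : hgraph -> Prop) :
  (2 <= n)%N -> measurable [set w | Q (G n w)]%classic.
Proof.
move=> n2; apply: (sigma_algebra_countable_preimage (f := G n) Q hgraph_code_inj).
  exact: sigma_algebra_measurable.
by move=> g; exact: (lda_measurable HG).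
Qed.

Definition degree_dist (i n k : nat) : R :=
  fine (P [set w | degree (G n w) i = k]%classic).

Definition joint_degree_dist (i n k l : nat) : R :=
  fine (P [set w | degree (G n w) i = k /\ degree (G n.+1 w) i = l]%classic).

Lemma measurable_joint_degree (i n k l : nat) : (2 <= n)%N ->
  measurable [set w | degree (G n w) i = k /\ degree (G n.+1 w) i = l]%classic.
Proof.
move=> n2; apply: measurableI.
  exact: (@measurable_preimage_graph n (fun g => degree g i = k)).
exact: (@measurable_preimage_graph n.+1 (fun g => degree g i = l) (leqW n2)).
Qed.

(** The event that the degree is [k] at time [n] lies in the filtration, and the conditional
    probability is constant on it, so its integral there is a product. *)
Lemma joint_degree_dist_succ (i n k : nat) :
  (1 <= i)%N -> (2 <= n)%N -> (i <= n)%N ->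
  joint_degree_dist i n k k.+1 = degree_dist i n k * attach_prob R n k.
Proof.
move=> i1 n2 iln; have iN : (1 <= i <= n)%N by rewrite i1.
have [_ _ /(_ [set w | degree (G n w) i = k]%classic)] := lda_transition HG n2 iN.
have FB : natural_filtration G n [set w | degree (G n w) i = k]%classic.
  by apply: (@natural_filtration_preimage n n (fun g => degree g i = k));
    rewrite n2 leqnn.
move=> /(_ FB) PB; rewrite /joint_degree_dist.
rewrite [X in P X](_ : _ = ([set w | G n.+1 w = add_vertex (G n w) n.+1 i] `&`
    [set w | degree (G n w) i = k])%classic); last first.
  apply/seteqP; split=> w /=; case: (degree_step w n2 iln) => -[Gw ->].
  - by case.
  - by move=> [-> /n_Sn].
  - by move=> [_ ->].
  - by case.
rewrite PB (eq_integral (cst (attach_prob R n k)%:E)); last first.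
  by move=> w; rewrite inE /= => ->.
have mB := @measurable_preimage_graph n (fun g => degree g i = k) n2.
by rewrite integral_cst // fineM ?fin_num_measure // mulrC.
Qed.

Lemma fine_probability_setU (A B C : set T) : measurable A -> measurable B ->
  (A `&` B = set0)%classic -> C = (A `|` B)%classic ->
  fine (P C) = fine (P A) + fine (P B).
Proof.
move=> mA mB AB ->; rewrite measureU //.
by rewrite fineD ?fin_num_measure.
Qed.

Lemma degree_dist_split (i n k : nat) : (2 <= n)%N -> (i <= n)%N ->
  degree_dist i n k = joint_degree_dist i n k k.+1 + joint_degree_dist i n k k.
Proof.
move=> n2 ni; apply: fine_probability_setU; try exact: measurable_joint_degree.
  by apply/seteqP; split=> // w /= [[_ ->] [_ /esym/n_Sn]].
apply/seteqP; split=> w /=; last by case=> -[].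
by move=> <-; case: (degree_step w n2 ni) => -[_ ->]; [left|right].
Qed.

Lemma degree_dist_succ0 (i n : nat) : (2 <= n)%N -> (i <= n)%N ->
  degree_dist i n.+1 0 = joint_degree_dist i n 0 0.
Proof.
move=> n2 ni; congr (fine (P _)); apply/seteqP; split=> w /=; last by case.
by case: (degree_step w n2 ni) => -[_ ->].
Qed.

Lemma degree_dist_succS (i n k : nat) : (2 <= n)%N -> (i <= n)%N ->
  degree_dist i n.+1 k.+1 =
  joint_degree_dist i n k k.+1 + joint_degree_dist i n k.+1 k.+1.
Proof.
move=> n2 ni; apply: fine_probability_setU; try exact: measurable_joint_degree.
  by apply/seteqP; split=> // w /= [[-> _] [/n_Sn]].
apply/seteqP; split=> w /=; last by case=> -[].
by case: (degree_step w n2 ni) => -[_ ->]; [case=> <-; left|move=> ->; right].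
Qed.

(** The chain starts at [maxn 2 i], when both the process and the vertex [i] exist. *)
Lemma degree_dist_chain (i : nat) : (1 <= i)%N ->
  attach_chain (maxn 2 i) (degree_dist i).
Proof.
move=> i1 n; rewrite geq_max => /andP[n2 ni].
(* The model prescribes only the jump probability; staying is its complement because the degree has
   just two possible moves. *)
have stay k : joint_degree_dist i n k k = degree_dist i n k * (1 - attach_prob R n k).
  rewrite mulrBr mulr1 -joint_degree_dist_succ //.
  by rewrite [X in X - _]degree_dist_split // addrAC subrr add0r.
split=> [k|k nk||k].
- by rewrite fine_ge0.
- rewrite /degree_dist [X in P X](_ : _ = set0) ?measure0 //.
  apply/seteqP; split=> // w /= Dk; move: nk; rewrite -Dk.
  by rewrite ltnNge degree_le_size.
- by rewrite degree_dist_succ0 // stay.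
- by rewrite degree_dist_succS // stay joint_degree_dist_succ.
Qed.

(* Chebyshev's inequality, by summation over the values of the degree. *)
Lemma degree_deviation_le (i n : nat) (h t : R) : (2 <= n)%N -> 0 < t ->
  (P [set w | (t <= `|(degree (G n w) i)%:R - h|)%R]%classic <=
   (chain_mean (degree_dist i) n (fun k => (k%:R - h) ^+ 2) / t ^+ 2)%R%:E)%E.
Proof.
move=> n2 t0.
pose B k : set T := [set w | degree (G n w) i = k /\ t <= `|k%:R - h| ]%classic.
have mB k : measurable (B k).
  exact: (@measurable_preimage_graph n (fun g => degree g i = k /\ t <= `|k%:R - h|)).
rewrite [X in P X](_ : _ = \big[setU/set0]_(k < n.+1) B k); last first.
  rewrite -(bigcup_mkord n.+1 B); apply/seteqP; split=> w /=.
    by move=> tD; exists (degree (G n w) i) => //=; rewrite ltnS degree_le_size.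
  by case=> k _ [<-].
apply: le_trans (le_mu_bigsetU _ _) _ => //.
rewrite /chain_mean mulr_suml -sumEFin; apply: lee_sum => k _.
have mD := @measurable_preimage_graph n (fun g => degree g i = k) n2.
have PD : P [set w | degree (G n w) i = k]%classic = (degree_dist i n k)%:E.
  by rewrite fineK // fin_num_measure.
have q0 : 0 <= degree_dist i n k by rewrite fine_ge0.
have [tk|tk] := leP t `|k%:R - h|; last first.
  rewrite (_ : B k = set0) ?measure0; last first.
    by apply/seteqP; split=> // w [_]; rewrite leNgt tk.
  by rewrite lee_fin; apply: divr_ge0; [apply: mulr_ge0|]; rewrite ?sqr_ge0.
apply: (@le_trans _ _ (degree_dist i n k)%:E).
  by rewrite -PD; apply: le_measure; rewrite ?inE // => w [].
rewrite lee_fin ler_pdivlMr ?exprn_gt0 //; apply: ler_wpM2l => //.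
by rewrite -(real_normK (num_real (k%:R - h))) lerXn2r ?nnegrE ?normr_ge0 // ltW.
Qed.

End DegreeChain.

Theorem theorem2p1 (d : measure_display) (T : measurableType d) (R : realType)
    (P : probability T R) (G : nat -> T -> hgraph)
    (HG : linear_depreferential_attachment P G)
    (i : nat) (hi : (1 <= i)%N) :
  cvg_in_probability P
    (fun n w => (degree (G n w) i)%:R / ln (n%:R : R)) 1.
Proof.
move=> eps eps0.
have [C C0 second_moment] :=
  chain_second_moment (degree_dist_chain HG hi) (leq_maxl 2 i).
(* With [L = ln n], Chebyshev at [t = eps L / 2] gives [C(1+h)/t^2]. Since [1 + h <= 2 + L <= 3L]
   once [L >= 1], this is at most [12C/(eps^2 L)]. *)
apply: (@squeeze_cvge _ _ _ _ (cst 0%E) _ (fun n => (12 * C / eps ^+ 2 / ln n%:R)%:E)).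
- near=> n; apply/andP; split; first exact: measure_ge0.
  have n2 : (2 < n)%N by near: n; exact: nbhs_infty_gt.
  have ni : (maxn 2 i <= n)%N by near: n; exact: nbhs_infty_ge.
  have L1 : 1 <= ln (n%:R : R) by near: n; have /cvgryPge := @cvg_ln_nat R; apply.
  (* Ensures [|h - L| <= 1 <= eps L / 2], so replacing the centre [L] by [h] costs at most half of
     the deviation [eps L]. *)
  have L2 : 2 / eps <= ln (n%:R : R).
    by near: n; have /cvgryPge := @cvg_ln_nat R; apply.
  set L : R := ln n%:R in L1 L2 *; set h : R := series harmonic n.-2.
  have hL : `|h - L| <= 1 by exact: harmonic_series_ln_dist.
  have Le2 : 2 <= eps * L by move: L2; rewrite ler_pdivrMr // mulrC.
  have t0 : 0 < eps * L / 2 by lra.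
  apply: le_trans (_ : _ <=
    P [set w | (eps * L / 2 <= `|(degree (G n w) i)%:R - h|)%R]%classic)%E _.
    apply: le_measure; rewrite ?inE.
    + apply: (measurable_preimage_graph HG
        (fun g => eps < `|(degree g i)%:R / L - 1|)).
      exact: ltnW.
    + apply: (measurable_preimage_graph HG
        (fun g => eps * L / 2 <= `|(degree g i)%:R - h|)).
      exact: ltnW.
    + move=> w /=; set D : R := (degree _ _)%:R => epsD.
      have : eps * L < `|D - L|.
        rewrite (_ : D - L = (D / L - 1) * L); last first.
          by rewrite mulrBl mul1r divfK // gt_eqF //; lra.
        by rewrite normrM (ger0_norm (_ : 0 <= L)) ?ltr_pM2r //; lra.
      have := ler_normD (D - h) (h - L); rewrite addrA subrK; lra.
  apply: le_trans (degree_deviation_le HG i h (ltnW n2) t0) _.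
  rewrite lee_fin ler_pdivrMr ?exprn_gt0 //.
  apply: le_trans (second_moment n ni) _; rewrite -/h.
  rewrite [leRHS](_ : _ = C * (3 * L)); last by field; apply/andP; split; lra.
  by apply: ler_wpM2l => //; move: hL; rewrite ler_norml => /andP[]; lra.
- exact: cvg_cst.
- exact: cvg_inv_ln_nat.
Unshelve. all: by end_near.
Qed.
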